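(* Let $R_c,\kappa_1,\kappa_2>0$ and $c_1,c_2\ge 0$ be constants and $0<k_{min}<k_{max}$. The min-max problem $$\min_{p>0}\ \max_{k\in[k_{min},k_{max}]}|\rho_{SR}(k,p)|$$ is solved by the unique positive root $p^\ast$ of the nonlinear equation $$\rho_{SR}(k_{min},p^\ast)=\rho_{SR}(k_{max},p^\ast).$$
   Context: For $i=1,2$ let $\xi_i(k)=\frac{1}{\sqrt{c_i\kappa_i+\kappa_i^2k^2}}$. The convergence factor of the optimized Schwarz method with scaled Robin transmission condition with parameter $p$ is $$\rho_{SR}(k,p)=\frac{\xi_1(p)-\xi_1(k)}{\xi_1(p)+R_c+\xi_2(k)}\cdot\frac{\xi_2(p)-\xi_2(k)}{\xi_2(p)+R_c+\xi_1(k)} .$$ *)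

(* Defs.v *)
From HB Require Import structures.
From mathcomp Require Import all_boot all_order all_algebra.
From mathcomp Require Import all_classical all_reals.
Set Implicit Arguments.
Unset Strict Implicit.
Unset Printing Implicit Defensive.
Import Order.TTheory GRing.Theory Num.Theory.
Local Open Scope classical_set_scope.
Local Open Scope ring_scope.

Definition xi {R : realType} (c kappa k : R) : R :=
  1 / Num.sqrt (c * kappa + kappa ^+ 2 * k ^+ 2).

Definition rho_SR {R : realType} (Rc c1 c2 kappa1 kappa2 k p : R) : R :=
  let xi1 := xi c1 kappa1 in
  let xi2 := xi c2 kappa2 in
  ((xi1 p - xi1 k) / (xi1 p + Rc + xi2 k)) *
  ((xi2 p - xi2 k) / (xi2 p + Rc + xi1 k)).

Definition is_max {R : realType} (A : set R) (m : R) : Prop :=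
  A m /\ ubound A m.

Definition is_min {R : realType} (A : set R) (m : R) : Prop :=
  A m /\ lbound A m.

(* M is determined on P by its first condition, so the existential only says
   that the inner maximum is attained for every admissible p. *)
Definition solves_minmax {R : realType} {T U : Type}
    (P : set T) (K : set U) (F : U -> T -> R) (p0 : T) : Prop :=
  P p0 /\
  exists M : T -> R,
    (forall p, P p -> is_max [set F k p | k in K] (M p)) /\
    is_min [set M p | p in P] (M p0).

(* Main.v *)
Require Import Defs.
From HB Require Import structures.
From mathcomp Require Import all_boot all_order all_algebra.
From mathcomp Require Import all_classical all_reals.
From mathcomp Require Import ring lra.
From mathcomp Require Import topology normedtype realfun.
Set Implicit Arguments.
Unset Strict Implicit.
Unset Printing Implicit Defensive.
Import Order.TTheory GRing.Theory Num.Theory.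
Import numFieldNormedType.Exports.
Local Open Scope classical_set_scope.
Local Open Scope ring_scope.

(** The convergence factor is symmetric in the frequency [k] and the parameter
    [p], vanishes at [k = p], and grows strictly as either variable moves away
    from the other: as a function of each variable it is nonnegative and
    V-shaped.  Indeed both [xi] are positive and decreasing, so the two
    numerators always have the same sign, and, after exchanging the two
    denominators, each factor is a Moebius function [(x - a) / (x + s)] of one
    of the two values [xi k], increasing since [a + s > 0] ([rho_SR_incr],
    [rho_SR_decr]).

    Hence for fixed [p] the maximum over [k] is attained at an endpoint, and
    the outer problem is to minimize the larger of [rho kmin p] and
    [rho kmax p].  On [[kmin, kmax]] the former increases from 0 and the latter
    decreases to 0, so by continuity they cross exactly once, at some [pstar]
    ([equioscillation_exists], [equioscillation_inj]); outside that interval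
    the V shape in [k] makes one of them strictly larger, so there is no other
    crossing ([equioscillation_between]).  Left of [pstar] the value at [kmax]
    is at least the equilibrated value, and right of [pstar] the value at
    [kmin] is ([equioscillation_minimal]). *)

(** The derivative in [x] is [(a + s) / (x + s) ^+ 2]. *)
Lemma moebius_lt {R : realFieldType} (a s x y : R) :
  0 < a + s -> 0 < x + s -> x < y -> (x - a) / (x + s) < (y - a) / (y + s).
Proof.
move=> as0 xs0 xy; have ys0 : 0 < y + s by lra.
rewrite ltr_pdivrMr // mulrAC ltr_pdivlMr // -subr_gt0.
have -> : (y - a) * (x + s) - (x - a) * (y + s) = (y - x) * (a + s) by ring.
by rewrite mulr_gt0 // subr_gt0.
Qed.

Section ConvergenceFactor.
Variable R : realType.

Lemma radicand_gt0 (c kappa k : R) :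
  0 <= c -> 0 < kappa -> 0 < k -> 0 < c * kappa + kappa ^+ 2 * k ^+ 2.
Proof.
move=> c0 kappa0 k0.
by rewrite ltr_wpDl ?mulr_gt0 ?exprn_gt0 // mulr_ge0 // ltW.
Qed.

Lemma xi_gt0 (c kappa k : R) :
  0 <= c -> 0 < kappa -> 0 < k -> 0 < xi c kappa k.
Proof. by move=> *; rewrite divr_gt0 // sqrtr_gt0 radicand_gt0. Qed.

Lemma xi_lt (c kappa k l : R) : 0 <= c -> 0 < kappa -> 0 < k -> k < l ->
  xi c kappa l < xi c kappa k.
Proof.
move=> c0 kappa0 k0 kl; have l0 := lt_trans k0 kl.
rewrite /xi !div1r ltf_pV2 ?posrE ?sqrtr_gt0 ?radicand_gt0 //.
rewrite ltr_sqrt ?radicand_gt0 // ltrD2l ltr_pM2l ?exprn_gt0 //.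
by rewrite ltrXn2r // ?nnegrE ltW.
Qed.

Lemma xi_le (c kappa k l : R) : 0 <= c -> 0 < kappa -> 0 < k -> k <= l ->
  xi c kappa l <= xi c kappa k.
Proof.
move=> c0 kappa0 k0; rewrite le_eqVlt => /predU1P[-> //|kl].
exact/ltW/xi_lt.
Qed.

Lemma xi_continuous (c kappa k : R) : 0 <= c -> 0 < kappa -> 0 < k ->
  {for k, continuous (xi c kappa)}.
Proof.
move=> c0 kappa0 k0; rewrite /xi.
apply: cvgM; first exact: cvg_cst.
apply: cvgV; first by rewrite gt_eqF // sqrtr_gt0 radicand_gt0.
apply: continuous_cvg; first exact: sqrt_continuous.
apply: cvgD; first exact: cvg_cst.
by apply: cvgM; [exact: cvg_cst|exact: exprn_continuous].
Qed.

Variables Rc c1 c2 kappa1 kappa2 : R.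
Hypotheses (Rc_gt0 : 0 < Rc) (kappa1_gt0 : 0 < kappa1) (kappa2_gt0 : 0 < kappa2).
Hypotheses (c1_ge0 : 0 <= c1) (c2_ge0 : 0 <= c2).

Local Notation rho := (rho_SR Rc c1 c2 kappa1 kappa2).
Local Notation xi1 := (xi c1 kappa1).
Local Notation xi2 := (xi c2 kappa2).

Let xi1_gt0 (k : R) : 0 < k -> 0 < xi1 k. Proof. exact: xi_gt0. Qed.
Let xi2_gt0 (k : R) : 0 < k -> 0 < xi2 k. Proof. exact: xi_gt0. Qed.

(** Exchanging [k] and [p] exchanges the two denominators and changes the sign
    of both numerators. *)
Lemma rho_SR_sym (k p : R) : rho k p = rho p k.
Proof.
rewrite /rho_SR /= mulf_div [RHS]mulf_div -[xi1 k - xi1 p]opprB.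
rewrite -[xi2 k - xi2 p]opprB mulrNN; congr (_ / _); ring.
Qed.

(** The form in which each factor depends on [k] through only one of the
    [xi]. *)
Lemma rho_SR_moebius (k p : R) : rho k p =
  ((xi1 k - xi1 p) / (xi1 k + (xi2 p + Rc))) *
  ((xi2 k - xi2 p) / (xi2 k + (xi1 p + Rc))).
Proof. by rewrite rho_SR_sym /rho_SR /=; congr (_ / _ * (_ / _)); ring. Qed.

Lemma rho_SR_diag (p : R) : rho p p = 0.
Proof. by rewrite /rho_SR /= subrr !mul0r. Qed.

Lemma rho_SR_decr (k l p : R) : 0 < k -> k < l -> l <= p -> rho l p < rho k p.
Proof.
move=> k0 kl lp; have l0 := lt_trans k0 kl; have p0 := lt_le_trans l0 lp.
have [Rc0 x1p x2p] := And3 Rc_gt0 (xi1_gt0 p0) (xi2_gt0 p0).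
have [x1l x2l] := (xi1_gt0 l0, xi2_gt0 l0).
rewrite !rho_SR_moebius; apply: ltr_pM.
- by rewrite divr_ge0 ?subr_ge0 ?xi_le //; lra.
- by rewrite divr_ge0 ?subr_ge0 ?xi_le //; lra.
- by apply: moebius_lt; rewrite ?xi_lt //; lra.
- by apply: moebius_lt; rewrite ?xi_lt //; lra.
Qed.

Lemma rho_SR_incr (k l p : R) : 0 < p -> p <= k -> k < l -> rho k p < rho l p.
Proof.
move=> p0 pk kl; have k0 := lt_le_trans p0 pk; have l0 := lt_trans k0 kl.
have [Rc0 x1p x2p] := And3 Rc_gt0 (xi1_gt0 p0) (xi2_gt0 p0).
have [x1k x2k] := (xi1_gt0 k0, xi2_gt0 k0).
have [x1l x2l] := (xi1_gt0 l0, xi2_gt0 l0).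
(* Here both Moebius factors are nonpositive and decrease with [k]. *)
rewrite !rho_SR_moebius -[ltLHS]mulrNN -[ltRHS]mulrNN; apply: ltr_pM.
- by rewrite -mulNr opprB divr_ge0 ?subr_ge0 ?xi_le //; lra.
- by rewrite -mulNr opprB divr_ge0 ?subr_ge0 ?xi_le //; lra.
- by rewrite ltrN2; apply: moebius_lt; rewrite ?xi_lt //; lra.
- by rewrite ltrN2; apply: moebius_lt; rewrite ?xi_lt //; lra.
Qed.

Lemma rho_SR_le_left (k l p : R) : 0 < k -> k <= l -> l <= p -> rho l p <= rho k p.
Proof.
move=> k0; rewrite le_eqVlt => /predU1P[-> //|kl lp].
exact/ltW/rho_SR_decr.
Qed.

Lemma rho_SR_le_right (k l p : R) : 0 < p -> p <= k -> k <= l -> rho k p <= rho l p.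
Proof.
move=> p0 pk; rewrite le_eqVlt => /predU1P[-> //|kl].
exact/ltW/rho_SR_incr.
Qed.

Lemma rho_SR_ge0 (k p : R) : 0 < k -> 0 < p -> 0 <= rho k p.
Proof.
move=> k0 p0; rewrite -(rho_SR_diag p).
by have [kp|/ltW pk] := leP k p; [exact: rho_SR_le_left|exact: rho_SR_le_right].
Qed.

Lemma rho_SR_continuous (k p : R) : 0 < k -> 0 < p -> {for p, continuous (rho k)}.
Proof.
move=> k0 p0; rewrite /rho_SR /=.
have [Rc0 x1p x2p] := And3 Rc_gt0 (xi1_gt0 p0) (xi2_gt0 p0).
have [x1k x2k] := (xi1_gt0 k0, xi2_gt0 k0).
have C1 := xi_continuous c1_ge0 kappa1_gt0 p0.
have C2 := xi_continuous c2_ge0 kappa2_gt0 p0.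
apply: cvgM.
- apply: cvgM; first by apply: cvgB; [exact: C1|exact: cvg_cst].
  apply: cvgV; first by rewrite gt_eqF //; lra.
  by do 2![apply: cvgD; last exact: cvg_cst]; exact: C1.
- apply: cvgM; first by apply: cvgB; [exact: C2|exact: cvg_cst].
  apply: cvgV; first by rewrite gt_eqF //; lra.
  by do 2![apply: cvgD; last exact: cvg_cst]; exact: C2.
Qed.

Variables kmin kmax : R.
Hypotheses (kmin_gt0 : 0 < kmin) (kmin_lt : kmin < kmax).

Let kmax_gt0 : 0 < kmax. Proof. exact: lt_trans kmin_lt. Qed.

(** The difference of the endpoint values is [- rho kmax kmin <= 0] at [kmin]
    and [rho kmin kmax >= 0] at [kmax]. *)
Lemma equioscillation_exists :
  exists2 p, kmin <= p <= kmax & rho kmin p = rho kmax p.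
Proof.
have [||c] := @IVT R (fun p => rho kmin p - rho kmax p) kmin kmax 0 (ltW kmin_lt).
- apply: continuous_in_subspaceT => p; rewrite inE /= in_itv /= => /andP[kp _].
  have p0 := lt_le_trans kmin_gt0 kp.
  by apply: cvgB; exact: rho_SR_continuous.
- rewrite !rho_SR_diag sub0r subr0 ge_min le_max oppr_le0.
  by rewrite !rho_SR_ge0 // orbT.
- by rewrite in_itv /= => kp /eqP; rewrite subr_eq0 => /eqP E; exists c.
Qed.

Lemma equioscillation_between (p : R) :
  0 < p -> rho kmin p = rho kmax p -> kmin <= p <= kmax.
Proof.
move=> p0 E; apply/andP; split; rewrite leNgt; apply/negP => lt.
- by have := rho_SR_incr p0 (ltW lt) kmin_lt; rewrite E ltxx.
- by have := rho_SR_decr kmin_gt0 kmin_lt (ltW lt); rewrite E ltxx.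
Qed.

(** Between [kmin] and [kmax] the value at [kmin] increases with the parameter
    and the value at [kmax] decreases. *)
Lemma equioscillation_inj (p q : R) : 0 < p -> 0 < q ->
  rho kmin p = rho kmax p -> rho kmin q = rho kmax q -> p = q.
Proof.
wlog : p q / p <= q => [H p0 q0 Ep Eq|].
  by have [pq|/ltW qp] := leP p q; [exact: H|apply/esym/H].
rewrite le_eqVlt => /predU1P[-> //|pq] p0 q0 Ep Eq.
have /andP[ap _] := equioscillation_between p0 Ep.
have /andP[_ qb] := equioscillation_between q0 Eq.
have := rho_SR_incr kmin_gt0 ap pq; have := rho_SR_decr p0 pq qb.
rewrite !(rho_SR_sym _ kmin) !(rho_SR_sym _ kmax) Ep Eq => lt1 lt2.
by have := lt_trans lt1 lt2; rewrite ltxx.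
Qed.

Lemma rho_SR_max_endpoints (p : R) : 0 < p ->
  is_max [set `|rho k p| | k in [set k | kmin <= k <= kmax]]
    (Num.max (rho kmin p) (rho kmax p)).
Proof.
move=> p0; split.
- have [_|_] := leP (rho kmin p) (rho kmax p).
  + by exists kmax; rewrite /= ?lexx ?ltW // ger0_norm // rho_SR_ge0.
  + by exists kmin; rewrite /= ?lexx ?ltW // ger0_norm // rho_SR_ge0.
- move=> _ [k /= /andP[ak kb] <-]; have k0 := lt_le_trans kmin_gt0 ak.
  rewrite ger0_norm ?rho_SR_ge0 // le_max.
  have [kp|/ltW pk] := leP k p; first by rewrite rho_SR_le_left.
  by apply/orP; right; exact: rho_SR_le_right.
Qed.

(** Decreasing the parameter below [pstar] worsens the factor at [kmax],
    increasing it worsens the factor at [kmin]. *)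
Lemma equioscillation_minimal (pstar p : R) : kmin <= pstar <= kmax ->
  rho kmin pstar = rho kmax pstar -> 0 < p ->
  Num.max (rho kmin pstar) (rho kmax pstar) <=
  Num.max (rho kmin p) (rho kmax p).
Proof.
move=> /andP[as_ sb] E p0; rewrite {1}E maxxx le_max.
have [ps|/ltW sp] := leP p pstar.
- by apply/orP; right; rewrite !(rho_SR_sym kmax) rho_SR_le_left.
- by apply/orP; left; rewrite -E !(rho_SR_sym kmin) rho_SR_le_right.
Qed.

End ConvergenceFactor.

Theorem theorem3p5 (R : realType) (Rc kappa1 kappa2 c1 c2 kmin kmax : R)
    (hRc : 0 < Rc) (hkappa1 : 0 < kappa1) (hkappa2 : 0 < kappa2)
    (hc1 : 0 <= c1) (hc2 : 0 <= c2) (hkmin : 0 < kmin) (hk : kmin < kmax) :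
  let rho := rho_SR Rc c1 c2 kappa1 kappa2 in
  exists pstar : R,
    unique (fun p : R => 0 < p /\ rho kmin p = rho kmax p) pstar /\
    solves_minmax [set p : R | 0 < p] [set k : R | kmin <= k <= kmax]
      (fun k p => `|rho k p|) pstar.
Proof.
move=> rho.
have [s kmin_s_kmax E] :=
  equioscillation_exists hRc hkappa1 hkappa2 hc1 hc2 hkmin hk.
have s0 : 0 < s by case/andP: kmin_s_kmax => + _; exact: lt_le_trans.
exists s; split; first split => // q [q0 Eq].
  exact: (equioscillation_inj hRc hkappa1 hkappa2 hc1 hc2 hkmin hk).
split => //; exists (fun p => Num.max (rho kmin p) (rho kmax p)); split.
  by move=> p p0; exact: rho_SR_max_endpoints.
split; first by exists s.
by move=> _ [p p0 <-]; exact: equioscillation_minimal.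
Qed.
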